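(* For every infinite Hausdorff topological space $X$, the space $H=\mathrm{USC}_p^{*}(X)$ does not satisfy the selection principle $\mathrm S_1(\mathcal P(H),\mathcal D(H))$.
   Context: The set ${}^X\mathbb R$ of all real functions on $X$ carries the product topology (pointwise convergence). $\mathrm{USC}_p^{*}(X)$ is the subspace of all bounded upper semicontinuous functions $f:X\to\mathbb R$ (i.e. $\{x:f(x)<a\}$ is open for every real $a$). $\mathrm S_1(\mathcal A,\mathcal B)$, for families $\mathcal A,\mathcal B$ of subsets of a set: for every sequence $\langle A_n:n\in\omega\rangle$ of elements of $\mathcal A$ there are $a_n\in A_n$ ($n\in\omega$) with $\{a_n:n\in\omega\}\in\mathcal B$. For $H\subseteq{}^X\mathbb R$: $\mathcal D(H)$ is the set of all $F\subseteq H$ dense in $H$; $\mathcal P(H)$ is the set of all $F\subseteq H$ that are pointwise dense in $\mathbb R$, i.e. $\overline{\{f(x):f\in F\}}=\mathbb R$ for each $x\in X$. *)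

(* Defs.v *)
From mathcomp Require Import all_boot all_order all_algebra.
From mathcomp Require Import all_classical all_reals all_analysis.
Import Order.TTheory GRing.Theory Num.Theory.
Import numFieldNormedType.Exports.

Set Implicit Arguments.
Unset Strict Implicit.
Unset Printing Implicit Defensive.

Local Open Scope classical_set_scope.
Local Open Scope ring_scope.

Definition selection_S1 (T : Type) (A B : set (set T)) : Prop :=
  forall U : nat -> set T, (forall n, A (U n)) ->
    exists a : nat -> T, (forall n, U n (a n)) /\ B (range a).

(* The library's [lower_semicontinuous] is for [\bar R]-valued functions. *)
Definition upper_semicontinuous (X : topologicalType) (R : realType)
    (f : X -> R) : Prop :=
  forall a : R, open [set x | f x < a].

(* [{ptws X -> R}] carries the product topology. *)
Definition USCp_bounded (X : topologicalType) (R : realType) :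
    set {ptws X -> R} :=
  [set f | upper_semicontinuous f /\ bounded_fun f].

(* [F] is dense in the subspace [H]: the closure is taken in the product, and
   the closure of [F] relative to [H] is its trace on [H]. *)
Definition dense_subsets (X : topologicalType) (R : realType)
    (H : set {ptws X -> R}) : set (set {ptws X -> R}) :=
  [set F | F `<=` H /\ H `<=` closure F].

Definition pointwise_dense_subsets (X : topologicalType) (R : realType)
    (H : set {ptws X -> R}) : set (set {ptws X -> R}) :=
  [set F | F `<=` H /\
    forall x : X, closure [set f x | f in F] = [set: R]].

Arguments USCp_bounded : clear implicits.

(* Main.v *)
Require Import Defs.
From mathcomp Require Import all_boot all_order all_algebra.
From mathcomp Require Import all_classical all_reals all_analysis.
Import numFieldNormedType.Exports.
Local Open Scope classical_set_scope.
Import Order.TTheory GRing.Theory Num.Theory.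
Local Open Scope ring_scope.

(** Pointwise density looks at one point at a time, density in the product at finitely many
    together. The constants take every real value at each point, yet all lie in the closed set of
    functions agreeing at two distinct points [x] and [y] ([closed_ptws_eq]). The indicator of [{x}]
    is in the space ([indic_USCp_bounded]) but not in that set, so offering the constants at every
    stage defeats any selection. *)

Lemma cst_USCp_bounded (R : realType) (X : topologicalType) (c : R) :
  USCp_bounded X R (cst c).
Proof.
split=> [a|]; last exact: bounded_cst.
have [ca|ac] := boolP (c < a).
  rewrite (_ : mkset _ = setT); first exact: openT.
  by apply/seteqP; split.
rewrite (_ : mkset _ = set0); first exact: open0.
by apply/seteqP; split=> // x /=; rewrite (negbTE ac).
Qed.

(** The set where the indicator is below [a] is empty, the complement of [A] or the whole space,
    according as [a <= 0], [0 < a <= 1] or [1 < a]. *)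
Lemma indic_USCp_bounded (R : realType) (X : topologicalType) (A : set X) :
  closed A -> USCp_bounded X R (\1_A : X -> R).
Proof.
move=> cA; split=> [a|]; last first.
  exists 1; split; first exact: num_real.
  move=> M M1 x _ /=; rewrite indicE normr_nat (le_trans _ (ltW M1))//.
  by rewrite lern1 leq_b1.
have [a0|a0] := leP a 0.
  rewrite (_ : mkset _ = set0); first exact: open0.
  apply/seteqP; split=> // x /=; rewrite indicE => xa.
  by have := lt_le_trans xa a0; rewrite ltrn0.
have [a1|a1] := leP a 1.
  rewrite (_ : mkset _ = ~` A); first exact: closed_openC.
  apply/seteqP; split=> x /=; rewrite indicE.
    by move=> /[swap] Ax; rewrite mem_set// ltNge a1.
  by move=> nAx; rewrite memNset.
rewrite (_ : mkset _ = setT); first exact: openT.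
apply/seteqP; split=> // x _ /=; rewrite indicE (le_lt_trans _ a1)//.
by rewrite lern1 leq_b1.
Qed.

(** Evaluations are projections of the product, hence continuous, so this is the zero set of a
    continuous function. *)
Lemma closed_ptws_eq (R : realType) (X : topologicalType) (x y : X) :
  closed [set f : {ptws X -> R} | f x = f y].
Proof.
rewrite (_ : mkset _ = (fun f : {ptws X -> R} => f x - f y) @^-1` [set 0]).
  apply: preimage_closed; last exact: closed_eq.
  have ev z : continuous (fun f : {ptws X -> R} => f z).
    exact: (@proj_continuous X (fun=> R) z).
  by move=> f _; exact: (cvgB (ev x f) (ev y f)).
by apply/seteqP; split=> f /= => [->|/subr0_eq//]; rewrite subrr.
Qed.

(* Constant functions alone are pointwise dense in [R], but by [closed_ptws_eq]
   their closure misses the indicator of a point. *)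
Theorem theorem5p4 (R : realType) (X : topologicalType)
    (X_infinite : infinite_set [set: X]) (X_hausdorff : hausdorff_space X) :
  ~ selection_S1 (pointwise_dense_subsets (USCp_bounded X R))
                 (dense_subsets (USCp_bounded X R)).
Proof.
have [x _] := infinite_setN0 X_infinite.
have [y [_ /= yx]] := infinite_setN0 (infinite_setD X_infinite (finite_set1 x)).
pose C : set {ptws X -> R} := range (fun c : R => cst c).
have CP : pointwise_dense_subsets (USCp_bounded X R) C.
  split=> [_ [c _ <-]|z]; first exact: cst_USCp_bounded.
  rewrite (_ : image _ _ = setT) ?closureT//.
  by apply/seteqP; split=> // c _; exists (cst c) => //; exists c.
move=> /(_ (fun=> C) (fun=> CP)) [a [aC [_ aD]]].
have x_closed : closed [set x].
  by apply: accessible_closed_set1; exact: hausdorff_accessible.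
have /aD := @indic_USCp_bounded R _ _ x_closed.
(* Whatever was selected, each [a n] is constant; by closedness, agreement at [x] and [y] passes to
   the indicator of [{x}], giving 1 = 0. *)
have aE : range a `<=` [set f : {ptws X -> R} | f x = f y].
  by move=> _ [n _ <-]; have [c _ <-] := aC n.
move=> /(closureS aE); rewrite -(closure_id _).1; last first.
  exact: closed_ptws_eq.
rewrite /= !indicE mem_set// memNset// => /eqP.
by rewrite oner_eq0.
Qed.
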